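(* There is an absolute constant $C>0$ such that for every finite set $A\subseteq\mathbb{R}$ with $|A|\ge 4$, the set $$h(A)=\{h(a,b,c,d,e): a,b,c,d,e\in A,\ a,b,c,d \text{ pairwise distinct},\ a,b,c,e \text{ pairwise distinct}\}\subseteq\mathbb{R}^2,$$ where $h(a,b,c,d,e)=\bigl(X(a,b,c,d),\,X(a,b,c,e)\bigr)$ and $X$ denotes the cross ratio, satisfies $$|h(A)|\ \ge\ C\,\frac{|A|^4}{\log |A|}.$$
   Context: For pairwise distinct $a,b,c,d\in\mathbb{R}$ the cross ratio is the real number $$X(a,b,c,d)=\frac{(a-b)(c-d)}{(b-c)(a-d)}.$$ It is defined only for pairwise distinct arguments, so $h(a,b,c,d,e)$ is defined exactly when both cross ratios appearing in it are defined. Here $|S|$ denotes the cardinality of a finite set $S$, and $\log$ is the natural logarithm. *)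

(* Defs.v *)
From mathcomp Require Import all_boot all_order all_algebra finmap.
From mathcomp Require Import all_classical all_reals all_analysis.
Set Implicit Arguments.
Unset Strict Implicit.
Unset Printing Implicit Defensive.
Import Order.TTheory GRing.Theory Num.Theory.
Local Open Scope fset_scope.
Local Open Scope classical_set_scope.
Local Open Scope ring_scope.

(* The cross ratio is meaningful only for pairwise distinct arguments; on
   other arguments this total function has an arbitrary value, and
   [pair_set] below never uses it there. *)
Definition cross_ratio (R : realType) (a b c d : R) : R :=
  ((a - b) * (c - d)) / ((b - c) * (a - d)).

Definition cross_ratio_pair (R : realType) (a b c d e : R) : R * R :=
  (cross_ratio a b c d, cross_ratio a b c e).

(* d = e is allowed. *)
Definition pair_set (R : realType) (A : {fset R}) : set (R * R) :=
  [set p | exists a b c d e : R,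
    [/\ [/\ a \in A, b \in A, c \in A, d \in A & e \in A],
        uniq [:: a; b; c; d],
        uniq [:: a; b; c; e] &
        p = cross_ratio_pair a b c d e]].

(* [fset_set] sends infinite sets to [fset0]; this shows that the cardinality
   of [fset_set (pair_set A)] is the genuine one. *)
Lemma finite_pair_set (R : realType) (A : {fset R}) : finite_set (pair_set A).
Proof.
have fA : finite_set [set` A] by exact: finite_fset.
pose f (t : R * R * R * R * R) :=
  cross_ratio_pair t.1.1.1.1 t.1.1.1.2 t.1.1.2 t.1.2 t.2.
apply: (@sub_finite_set _ _
  (f @` ([set` A] `*` [set` A] `*` [set` A] `*` [set` A] `*` [set` A]))).
  move=> p [a [b [c [d [e [[aA bA cA dA eA] _ _ ->]]]]]].
  by exists (a, b, c, d, e).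
by apply: finite_image; do 4!(apply: finite_setX => //).
Qed.

(* Main.v *)
Require Import Defs.
From mathcomp Require Import all_boot all_order all_algebra finmap.
From mathcomp Require Import all_classical all_reals all_analysis.
From mathcomp Require Import zify ring lra.
Import Order.TTheory GRing.Theory Num.Theory.
Local Open Scope fset_scope.
Local Open Scope ring_scope.

Set Implicit Arguments.
Unset Strict Implicit.
Unset Printing Implicit Defensive.

(* Two admissible 5-tuples with the same pair of cross ratios differ by a
   projective transformation, so collisions of [h] correspond to a triple of
   points (a,a'), (b,b'), (c,c') of the grid A x A together with two further
   points on the Moebius curve through them; with r the number of grid points on
   a curve, their number is at most the sum of r^5 over the curves.  A curve
   consists of two monotone branches, so when the grid is cut into t x t cells it
   meets at most 4t of them; if r >= 16t, at least r/2 of its points share a cell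
   with two others of its points.  As three points determine a curve, the sum of
   r over curves with r >= 16t is at most twice the number of triples of grid
   points inside one cell, which is O(n^6/t^4).  Since r^4 = O(1 + sum of t^3 over
   t <= r/16), the sum of r^5 is O(n^6 (1 + 1/2 + ... + 1/n)), and Cauchy-Schwarz
   concludes. *)

(** * Moebius curves over a field *)

Section MobiusForm.
Variable F : fieldType.
Implicit Types p q r z w : F * F.

(* The equality of cross ratios [X(p1,q1,r1,z1) = X(p2,q2,r2,z2)], cleared of
   denominators. *)
Definition mobius_form p q r z : F :=
  (p.1 - q.1) * (r.1 - z.1) * (q.2 - r.2) * (p.2 - z.2)
  - (p.2 - q.2) * (r.2 - z.2) * (q.1 - r.1) * (p.1 - z.1).

Definition generic p q := (p.1 != q.1) && (p.2 != q.2).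

Definition generic3 p q r := [&& generic p q, generic q r & generic p r].

(* Vanishes at z iff z lies on the graph of x |-> (a x + b) / (c x + d), when
   a d - b c != 0. *)
Definition lin (a b c d : F) z : F := a * z.1 + b - z.2 * (c * z.1 + d).

Lemma mobius_form_lin p q r : generic3 p q r ->
  exists a b c d, a * d - b * c != 0 /\ mobius_form p q r =1 lin a b c d.
Proof.
case: p q r => [a a'] [b b'] [c c'] /and3P[/andP[/= ab ab'] /andP[/= bc bc'] /andP[/= ac ac']].
(* With these the form reads u (c - x)(a' - y) - v (a - x)(c' - y), from which the coefficients are
   read off. *)
pose u := (a - b) * (b' - c'); pose v := (a' - b') * (b - c).
exists (v * c' - u * a'), (u * c * a' - v * c' * a), (v - u), (u * c - v * a).
split; last by case=> x y; rewrite /mobius_form /lin /u /v /=; ring.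
rewrite (_ : _ - _ = - (u * v * (a - c) * (c' - a'))); last by ring.
by rewrite oppr_eq0 /u /v !mulf_neq0 // subr_eq0 // eq_sym.
Qed.

Lemma mobius_form_nodes p q r :
  [/\ mobius_form p q r p = 0, mobius_form p q r q = 0
    & mobius_form p q r r = 0].
Proof. by rewrite /mobius_form; split; ring. Qed.

Lemma cross_ratio_eq_mobius_form p q r z :
  generic3 p q r -> generic p z ->
  (p.1 - q.1) * (r.1 - z.1) / ((q.1 - r.1) * (p.1 - z.1)) =
  (p.2 - q.2) * (r.2 - z.2) / ((q.2 - r.2) * (p.2 - z.2)) ->
  mobius_form p q r z = 0.
Proof.
case: p q r z => [a a'] [b b'] [c c'] [x y].
move=> /and3P[/andP[/= ab ab'] /andP[/= bc bc'] /andP[/= ac ac']] /andP[/= ax ay].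
move/eqP; rewrite eqr_div ?mulf_neq0 ?subr_eq0// => /eqP E.
rewrite /mobius_form /=; apply/eqP; rewrite subr_eq0; apply/eqP.
by rewrite -!mulrA in E *; rewrite E; ring.
Qed.

Section Graph.
Variables a b c d : F.
Hypothesis det_neq0 : a * d - b * c != 0.
Let den z := c * z.1 + d.

(** At a zero of the denominator the numerator would vanish too, and the determinant is a
    combination of the two. *)
Lemma lin_den_neq0 z : lin a b c d z = 0 -> den z != 0.
Proof.
rewrite /lin /den; case: z => x y /= E; apply: contra det_neq0 => /eqP h.
move: E; rewrite h mulr0 subr0 => E.
have -> : a * d - b * c = a * (c * x + d) - c * (a * x + b) by ring.
by rewrite h E !mulr0 subr0.
Qed.

(** Difference formula for a Moebius map; it yields both injectivity and monotonicity on
    branches. *)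
Lemma lin_diff z w : lin a b c d z = 0 -> lin a b c d w = 0 ->
  (z.2 - w.2) * (den z * den w) = (a * d - b * c) * (z.1 - w.1).
Proof.
rewrite /lin /den; case: z w => x y [x' y'] /= /eqP; rewrite subr_eq0 => /eqP Ez.
move=> /eqP; rewrite subr_eq0 => /eqP Ew.
transitivity ((y * (c * x + d)) * (c * x' + d) - (y' * (c * x' + d)) * (c * x + d)).
  by ring.
by rewrite -Ez -Ew; ring.
Qed.

Lemma lin_generic z w : lin a b c d z = 0 -> lin a b c d w = 0 ->
  z != w -> generic z w.
Proof.
move=> Ez Ew zw; have D := lin_diff Ez Ew.
have nz := lin_den_neq0 Ez; have nw := lin_den_neq0 Ew.
have E : (z.2 == w.2) = (z.1 == w.1).
  rewrite -[LHS]subr_eq0 -[RHS]subr_eq0; apply/eqP/eqP => h; move: D.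
    by rewrite h mul0r => /esym/eqP; rewrite mulf_eq0 (negPf det_neq0) => /eqP.
  by rewrite h mulr0 => /eqP; rewrite mulf_eq0 mulf_eq0 (negPf nz) (negPf nw) !orbF => /eqP.
rewrite /generic E andbb; apply: contra zw => /eqP h.
by move: E; rewrite h eqxx => /eqP; case: z w h {Ez Ew D nz nw} => ? ? [? ?] /= -> ->.
Qed.

(** Three points determine the curve: once each second coordinate is replaced by the value of the
    map, the form is [lin] up to factors that are nonzero for generic points. *)
Lemma mobius_form_proportional p q r z :
  lin a b c d p = 0 -> lin a b c d q = 0 -> lin a b c d r = 0 ->
  mobius_form p q r z * (den p * den q * den r) =
  (a * d - b * c) * ((p.1 - q.1) * (q.1 - r.1) * (r.1 - p.1)) * lin a b c d z.
Proof.
move=> Ep Eq Er.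
have := lin_den_neq0 Ep; have := lin_den_neq0 Eq; have := lin_den_neq0 Er.
move: Ep Eq Er; rewrite /lin /den /mobius_form.
case: p q r z => [x1 y1] [x2 y2] [x3 y3] [x y] /=.
move=> /eqP; rewrite subr_eq0 => /eqP E1.
move=> /eqP; rewrite subr_eq0 => /eqP E2.
move=> /eqP; rewrite subr_eq0 => /eqP E3 n3 n2 n1.
have -> : y1 = (a * x1 + b) / (c * x1 + d) by rewrite E1 mulfK.
have -> : y2 = (a * x2 + b) / (c * x2 + d) by rewrite E2 mulfK.
have -> : y3 = (a * x3 + b) / (c * x3 + d) by rewrite E3 mulfK.
by field; rewrite n1 n2 n3.
Qed.

Lemma lin_mobius_form0 p q r z :
  lin a b c d p = 0 -> lin a b c d q = 0 -> lin a b c d r = 0 ->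
  generic3 p q r -> (mobius_form p q r z == 0) = (lin a b c d z == 0).
Proof.
move=> Ep Eq Er /and3P[/andP[pq _] /andP[qr _] /andP[pr _]].
have := mobius_form_proportional z Ep Eq Er; set X := mobius_form _ _ _ _ => E.
have N : den p * den q * den r != 0 by rewrite !mulf_neq0 // lin_den_neq0.
have M : (a * d - b * c) * ((p.1 - q.1) * (q.1 - r.1) * (r.1 - p.1)) != 0.
  by rewrite !mulf_neq0 // subr_eq0 // eq_sym.
apply/eqP/eqP => h; move: E; rewrite h ?mul0r ?mulr0 => /eqP.
  by rewrite eq_sym mulf_eq0 (negPf M) => /eqP.
by rewrite mulf_eq0 (negPf N) orbF => /eqP.
Qed.

End Graph.
End MobiusForm.

(** * Curves in the index grid *)

Section Grid.
(** [f] enumerates the set increasingly; grid points are pairs of indices, so that cells can be cut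
    by integer division. *)
Variables (F : realFieldType) (n : nat) (f : 'I_n -> F).
Hypothesis f_mono : forall i j, (f i < f j) = (i < j)%N.

Notation T := ('I_n * 'I_n)%type.
Implicit Types p q r z w : T.

Definition pt z : F * F := (f z.1, f z.2).

Definition curve (P : T * T * T) : {set T} :=
  [set z | mobius_form (pt P.1.1) (pt P.1.2) (pt P.2) (pt z) == 0].

Definition gtriple (P : T * T * T) := generic3 (pt P.1.1) (pt P.1.2) (pt P.2).

Lemma grid_inj : injective f.
Proof.
move=> i j fij; apply/val_inj => /=.
by case: (ltngtP i j) => //; rewrite -f_mono fij ltxx.
Qed.

Let pt_inj : injective pt.
Proof. by case=> i j [k l] [/grid_inj-> /grid_inj->]. Qed.

Lemma curve_lin P : gtriple P -> exists a b c d, a * d - b * c != 0 /\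
  forall z, (z \in curve P) = (lin a b c d (pt z) == 0).
Proof.
move=> /mobius_form_lin[a [b [c [d [D E]]]]]; exists a, b, c, d; split=> // z.
by rewrite inE E.
Qed.

Lemma curve_nodes P : [/\ P.1.1 \in curve P, P.1.2 \in curve P & P.2 \in curve P].
Proof.
have [h1 h2 h3] := mobius_form_nodes (pt P.1.1) (pt P.1.2) (pt P.2).
by rewrite !inE h1 h2 h3 eqxx.
Qed.

Lemma curve_generic P z w : gtriple P -> z \in curve P -> w \in curve P ->
  z != w -> generic (pt z) (pt w).
Proof.
move=> /curve_lin[a [b [c [d [D E]]]]]; rewrite !E => /eqP hz /eqP hw zw.
by apply: (lin_generic D hz hw); rewrite (inj_eq pt_inj).
Qed.

(** Hence distinct points p, q, r lie together on one curve only, so triples can be counted instead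
    of curves. *)
Lemma curve_triple P p q r : gtriple P ->
  p \in curve P -> q \in curve P -> r \in curve P ->
  p != q -> q != r -> p != r ->
  gtriple (p, q, r) /\ curve (p, q, r) = curve P.
Proof.
move=> gP hp hq hr pq qr pr.
have g : gtriple (p, q, r).
  by apply/and3P; split; exact: (curve_generic gP).
split=> //; apply/finset.setP => z.
have [a [b [c [d [D E]]]]] := curve_lin gP.
move: hp hq hr; rewrite !E => /eqP hp /eqP hq /eqP hr.
by rewrite inE /= (lin_mobius_form0 D _ hp hq hr).
Qed.

Lemma curve_fst_inj P : gtriple P -> {in curve P &, injective fst}.
Proof.
move=> gP z w hz hw E; apply/eqP/negP => /negP zw.
by have /andP[/=] := curve_generic gP hz hw zw; rewrite E eqxx.
Qed.

(** The branch is the sign of the denominator. On one branch the product of denominators in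
    [lin_diff] is positive, so the sign of the determinant decides the direction. *)
Lemma curve_branches P : gtriple P -> exists (inc : bool) (br : T -> bool),
  {in curve P &, forall z w, br z = br w -> (z.1 < w.1)%N ->
    if inc then (z.2 < w.2)%N else (w.2 < z.2)%N}.
Proof.
move=> /curve_lin[a [b [c [d [D E]]]]].
exists (0 < a * d - b * c), (fun z => 0 < c * (pt z).1 + d) => z w.
rewrite !E => /eqP hz /eqP hw br.
have := lin_diff hz hw; have := lin_den_neq0 D hz; have := lin_den_neq0 D hw.
rewrite -!f_mono /= in br *.
set A := c * f z.1 + d in br *; set B := c * f w.1 + d in br *.
move=> nB nA Eq zw.
have AB : 0 < A * B.
  case: (ltrP 0 A) br => [A0 /esym B0|A0 /esym/negbT].
    by rewrite mulr_gt0.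
  rewrite -leNgt => B0.
  by rewrite nmulr_rgt0 lt_neqAle ?nA ?nB.
case: ltrP => D0.
  by rewrite -subr_lt0 -(pmulr_llt0 _ AB) Eq pmulr_rlt0 // subr_lt0.
have D1 : a * d - b * c < 0 by rewrite lt_neqAle D.
by rewrite -subr_gt0 -(pmulr_lgt0 _ AB) Eq nmulr_rgt0 // subr_lt0.
Qed.

End Grid.

(** * Cells and heavy points *)

Section Cells.
Local Open Scope nat_scope.
Variables (n w : nat).
Hypothesis w_gt0 : 0 < w.
Notation T := ('I_n * 'I_n)%type.
Implicit Types (p q r z u : T) (S : {set T}).

Definition cell z : nat * nat := (z.1 %/ w, z.2 %/ w).

(** The count includes [z] itself, so two further points of [S] share its cell. *)
Definition heavy S : {set T} :=
  [set z in S | 2 < #|[set u in S | cell u == cell z]|].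

Definition local_triple (P : T * T * T) :=
  (cell P.1.2 == cell P.1.1) && (cell P.2 == cell P.1.1).

Lemma card_cell_le c : #|[set z : T | cell z == c]| <= w ^ 2.
Proof.
(* Inside a cell the quotients by [w] are fixed, so the two remainders determine the point. *)
pose g (z : T) := (Ordinal (ltn_pmod z.1 w_gt0), Ordinal (ltn_pmod z.2 w_gt0)).
have gi : {in [set z | cell z == c] &, injective g}.
  move=> [i j] [k l]; rewrite !inE => /eqP <- /eqP[/= e1 e2] [h1 h2].
  congr pair; apply/val_inj => /=.
    by rewrite (divn_eq i w) h1 -e1 -divn_eq.
  by rewrite (divn_eq j w) h2 -e2 -divn_eq.
rewrite -(card_in_imset gi) (leq_trans (max_card _)) //.
by rewrite card_prod card_ord mulnn.
Qed.

(** There are n ^ 2 first points, and at most w ^ 2 choices in its cell for each of the other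
    two. *)
Lemma card_local_triple_le : #|[set P | local_triple P]| <= n ^ 2 * w ^ 4.
Proof.
rewrite -sum1_card (eq_bigl local_triple); last by move=> P; rewrite inE.
rewrite (partition_big (fun P : T * T * T => P.1.1) predT) //=.
apply: (@leq_trans (\sum_(p : T) w ^ 4)); last first.
  by rewrite sum_nat_const card_prod card_ord mulnn.
apply: leq_sum => p _; rewrite sum1dep_card.
pose C := [set z : T | cell z == cell p].
apply: (@leq_trans #|finset.setX [set p] (finset.setX C C)|).
  rewrite -(@card_imset _ _ (fun P : T * T * T => (P.1.1, (P.1.2, P.2)))); last first.
    by move=> [[x1 x2] x3] [[y1 y2] y3] [-> -> ->].
  apply/subset_leq_card/fintype.subsetP => y /imsetP[[[p' q] r]].
  by rewrite !inE /= => /andP[/andP[/= hq hr] /eqP <-] ->; rewrite /= eqxx hq hr.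
rewrite !cardsX cards1 mul1n (expnM w 2 2) expnS expn1.
by rewrite leq_mul // card_cell_le.
Qed.

Definition distinct_triple (P : T * T * T) :=
  [&& P.1.1 != P.1.2, P.1.2 != P.2 & P.1.1 != P.2].

(** Every heavy point is the first entry of such a triple, so the first projection covers
    [heavy S]. *)
Lemma card_heavy_le S : #|heavy S| <=
  #|[set P | [&& local_triple P, distinct_triple P,
               P.1.1 \in S, P.1.2 \in S & P.2 \in S]]|.
Proof.
apply: (leq_trans _ (leq_imset_card (fun P : T * T * T => P.1.1) _)).
apply/subset_leq_card/fintype.subsetP => z; rewrite inE => /andP[zS].
rewrite (cardsD1 z) inE zS eqxx /= add1n ltnS => /card_gt1P[u [v []]].
rewrite !inE => /and3P[uz uS uc] /and3P[vz vS vc] uv.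
apply/imsetP; exists (z, u, v) => //.
by rewrite inE /local_triple /distinct_triple /= uc vc uS vS zS uv
  (eq_sym z) uz (eq_sym z) vz.
Qed.

(* On a monotone branch the cells visited form a chain, hence are told apart
   by the sum (or difference) of their coordinates. *)
Lemma card_le_heavy t S (inc : bool) (br : T -> bool) :
  n < w * t ->
  {in S &, injective fst} ->
  {in S &, forall z u, br z = br u -> z.1 < u.1 ->
     if inc then z.2 < u.2 else u.2 < z.2} ->
  #|S| <= #|heavy S| + 8 * t.
Proof.
move=> nwt inj1 mono.
have t0 : 0 < t by case: t nwt; rewrite ?muln0.
have lt_t (i : 'I_n) : i %/ w < t by rewrite ltn_divLR // mulnC (ltn_trans _ nwt).
(* Quotients are at most [t.-1], so the subtraction never truncates and [key] stays below 2 t. *)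
pose key (z : T) := z.1 %/ w + if inc then z.2 %/ w else t.-1 - z.2 %/ w.
have key_lt z : key z < 2 * t.
  move: (lt_t z.1) (lt_t z.2); rewrite /key.
  by move: (z.1 %/ w) (z.2 %/ w) => i j; case: (inc); lia.
have key_lt_cell z u : z \in S -> u \in S -> br z = br u -> key z = key u ->
    z.1 < u.1 -> cell z = cell u.
  move=> zS uS bzu kzu lt1; have := mono _ _ zS uS bzu lt1; move: kzu.
  move: (leq_div2r w (ltnW lt1)) (lt_t z.2) (lt_t u.2); rewrite /key /cell.
  by case: (inc) => ? ? ? ? /ltnW/(leq_div2r w) ?; congr pair; lia.
have key_cell z u : z \in S -> u \in S -> br z = br u -> key z = key u ->
    cell z = cell u.
  move=> zS uS bzu kzu; case: (ltngtP z.1 u.1) => [lt1|lt1|/val_inj eq1].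
  - exact: key_lt_cell.
  - by apply/esym/key_lt_cell.
  - by rewrite (inj1 _ _ zS uS eq1).
have hS : heavy S \subset S by apply/fintype.subsetP => z; rewrite inE => /andP[].
rewrite -(cardsID (heavy S) S) (finset.setIidPr hS) leq_add2l.
rewrite -sum1_card.
rewrite (partition_big (fun z => (br z, Ordinal (key_lt z))) predT) //=.
(* Each of the 4 t pairs of a branch and a key selects at most one cell, holding at most two points
   that are not heavy. *)
apply: (@leq_trans (\sum_(k : bool * 'I_(2 * t)) 2)); last first.
  by rewrite sum_nat_const card_prod card_bool card_ord; lia.
apply: leq_sum => -[b k] _; rewrite sum1dep_card.
set X := [set _ | _].
case: (set_0Vmem X) => [->|[z]]; first by rewrite cards0.
rewrite !inE => /andP[/andP[]]; rewrite negb_and -leqNgt.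
move=> /orP[/negPf-> //|hz] zS /eqP[bz kz].
apply: leq_trans hz; apply/subset_leq_card/fintype.subsetP => u; rewrite !inE.
move=> /andP[/andP[_ uS] /eqP[bu ku]]; rewrite uS /=; apply/eqP.
by apply: key_cell; rewrite ?bu ?bz //; have := congr1 val ku; rewrite /= -kz.
Qed.

End Cells.

(** * Summation over curves *)

Section Energy.
Local Open Scope nat_scope.
Variables (F : realFieldType) (n : nat) (f : 'I_n -> F).
Hypothesis f_mono : forall i j, (f i < f j)%R = (i < j).
Notation T := ('I_n * 'I_n)%type.
Implicit Types (P : T * T * T) (S : {set T}).

Definition curves : {set {set T}} := curve f @: [set P | gtriple f P].

(** A local triple of distinct points is charged to a single curve, so the triples, partitioned by
    their curve, dominate all heavy points. *)
Lemma sum_heavy_le w : 0 < w -> \sum_(S in curves) #|heavy w S| <= n ^ 2 * w ^ 4.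
Proof.
move=> w0; apply: leq_trans (card_local_triple_le n w0).
rewrite -sum1_card (partition_big (curve f) predT) //=.
rewrite big_mkcond; apply: leq_sum => S _; case: ifP => // /imsetP[P].
rewrite inE => gP ->{S}; rewrite sum1dep_card.
have := curve_triple f_mono gP; move: (curve f P) => S triple_S.
apply: (leq_trans (card_heavy_le w _)).
apply/subset_leq_card/fintype.subsetP => -[[p q] r]; rewrite !inE.
case/and5P=> -> /and3P[/= pq qr pr] hp hq hr.
by have [_ ->] := triple_S _ _ _ hp hq hr pq qr pr; rewrite eqxx.
Qed.

Lemma card_curve_gt2 P : gtriple f P -> 2 < #|curve f P|.
Proof.
move=> gP; have [h1 h2 h3] := curve_nodes f P; apply/card_gt2P.
exists P.1.1, P.1.2, P.2; split; split=> //.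
- by apply: contraTneq gP => e; rewrite /gtriple /generic3 /generic e !eqxx.
- by apply: contraTneq gP => e; rewrite /gtriple /generic3 /generic e !eqxx !andbF.
- by apply: contraTneq gP => e; rewrite /gtriple /generic3 /generic e !eqxx !andbF.
Qed.

Lemma card_curve_le P : gtriple f P -> #|curve f P| <= n.
Proof.
move=> gP; rewrite -(card_in_imset (curve_fst_inj f_mono gP)).
by rewrite (leq_trans (max_card _)) // card_ord.
Qed.

(** Take w = n: the grid is one cell, and every point of a curve is heavy because the curve has at
    least three. *)
Lemma sum_card_curves_le : 0 < n -> \sum_(S in curves) #|S| <= n ^ 6.
Proof.
move=> n0; rewrite (expnD n 2 4); apply: leq_trans (sum_heavy_le n0).
apply: leq_sum => S /imsetP[P]; rewrite inE => gP ->{S}.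
apply/subset_leq_card/fintype.subsetP => z zS; rewrite inE zS.
apply: (leq_trans (card_curve_gt2 gP)); apply/subset_leq_card/fintype.subsetP => u uS.
by rewrite inE uS /cell !divn_small.
Qed.

(** At most 8 t points, half of the curve or less, fail to be heavy. The constant 32 is this factor
    2 times the 2 ^ 4 from w t <= 2 n. *)
Lemma sum_rich_curves_le t : 0 < t <= n ->
  t ^ 4 * \sum_(S in curves | 16 * t <= #|S|) #|S| <= 32 * n ^ 6.
Proof.
case/andP=> t0 tn; pose w := (n %/ t).+1.
have nwt : n < w * t by rewrite -ltn_divLR.
have wt : w * t <= 2 * n.
  by rewrite mul2n mulSn addnC -addnn leq_add // leq_trunc_div.
have w0 : 0 < w by []; clearbody w.
have -> : 32 * n ^ 6 = 2 * (n ^ 2 * (2 * n) ^ 4).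
  by rewrite expnMn (mulnCA _ (2 ^ 4)) mulnA -(expnD n 2 4).
apply: (@leq_trans (t ^ 4 * (2 * (n ^ 2 * w ^ 4)))); last first.
  rewrite mulnCA leq_mul2l mulnCA leq_mul2l -expnMn (mulnC t).
  by rewrite leq_exp2r ?wt ?orbT.
rewrite leq_mul2l; apply/orP; right.
apply: leq_trans (leq_mul (leqnn 2) (sum_heavy_le w0)).
rewrite big_distrr /= big_mkcondr; apply: leq_sum => S.
move=> /imsetP[P]; rewrite inE => gP ->{S}; case: ifP => // ts.
have [inc [br mono]] := curve_branches f_mono gP.
have := card_le_heavy w0 nwt (curve_fst_inj f_mono gP) mono.
by move: (#|curve f P|) (#|heavy w (curve f P)|) ts => x y; lia.
Qed.

(** Trades a power of s for a sum over thresholds t with 16 t <= s. Rounding s up to a multiple of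
    16 costs 16 ^ 4, the induction on the quotient another 16. *)
Lemma expn4_le_sum_cubes s :
  s ^ 4 <= 2 ^ 20 * (1 + \sum_(1 <= t < (s %/ 16).+1) t ^ 3).
Proof.
have H m : m.+1 ^ 4 <= 16 * (1 + \sum_(1 <= t < m.+1) t ^ 3).
  elim: m => [|m IH]; first by rewrite big_nil.
  rewrite big_nat_recr //=; nia.
apply: (@leq_trans ((16 * (s %/ 16).+1) ^ 4)).
  by rewrite leq_exp2r // ltnW // mulnC -ltn_divLR.
by rewrite expnMn (expnD 2 16 4) -mulnA leq_mul2l H orbT.
Qed.

(** A curve contains the three points of any triple defining it, so at most |S| ^ 3 triples define
    [S]. *)
Lemma sum_card_curve_sqr_le : \sum_(P | gtriple f P) #|curve f P| ^ 2 <=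
  \sum_(S in curves) #|S| ^ 5.
Proof.
rewrite (partition_big (curve f) (mem curves)) /=; last first.
  by move=> P gP; apply: imset_f; rewrite inE.
apply: leq_sum => S _.
rewrite (eq_bigr (fun=> #|S| ^ 2)); last by move=> P /andP[_ /eqP->].
rewrite sum_nat_cond_const (expnD _ 3 2) leq_mul2r; apply/orP; right.
apply: (@leq_trans #|finset.setX (finset.setX S S) S|); last first.
  by rewrite !cardsX !expnS mulnA muln1.
apply/subset_leq_card/fintype.subsetP => P; rewrite !inE => /andP[_ /eqP<-].
by have [-> -> ->] := curve_nodes f P.
Qed.

End Energy.

(** Four of the five factors |S| become a sum of cubes; after exchanging sums, t ^ 3 meets the bound
    32 n ^ 6 / t ^ 4 and leaves a harmonic sum. *)
Lemma energy_le (F : realFieldType) n (f : 'I_n -> F) : (0 < n)%N ->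
  (forall i j, (f i < f j) = (i < j)%N) ->
  (\sum_(P | gtriple f P) #|curve f P| ^ 2)%N%:R <=
  2 ^+ 20 * n%:R ^+ 6 * (1 + 32 * \sum_(1 <= t < n.+1) t%:R^-1) :> F.
Proof.
move=> n0 f_mono.
pose W t := (\sum_(S in curves f | 16 * t <= #|S|) #|S|)%N.
have E : (\sum_(P | gtriple f P) #|curve f P| ^ 2 <=
    2 ^ 20 * (n ^ 6 + \sum_(1 <= t < n.+1) t ^ 3 * W t))%N.
  apply: (leq_trans (sum_card_curve_sqr_le f)).
  apply: (@leq_trans (\sum_(S in curves f)
      2 ^ 20 * (#|S| + \sum_(1 <= t < n.+1 | 16 * t <= #|S|) t ^ 3 * #|S|))%N).
    apply: leq_sum => S /imsetP[P]; rewrite inE => gP ->{S}.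
    set s := #|_|; rewrite expnS.
    apply: (leq_trans (leq_mul (leqnn _) (expn4_le_sum_cubes s))).
    rewrite mulnCA leq_mul2l; apply/orP; right.
    rewrite mulnDr muln1 leq_add2l mulnC big_distrl /=.
    (* The thresholds available to a curve all lie in the common range 1 to n. *)
    have sn : (s %/ 16 <= n)%N.
      by apply: leq_trans (leq_div _ _) (card_curve_le f_mono gP).
    rewrite [leqRHS](big_cat_nat _ (n := (s %/ 16).+1)) //=.
    rewrite [leqLHS]big_nat [X in (_ <= X + _)%N]big_nat_cond.
    apply: (leq_trans _ (leq_addr _ _)); apply: eq_leq; apply: eq_bigl => t.
    by rewrite ltnS leq_divRL // mulnC; case: (1 <= t)%N => //=; rewrite andbb.
  rewrite -big_distrr /= leq_mul2l; apply/orP; right.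
  rewrite big_split /= leq_add ?sum_card_curves_le //.
  rewrite (exchange_big_dep predT) //=; apply: leq_sum => t _.
  by rewrite big_distrr.
move: E; rewrite -(ler_nat F) => /le_trans; apply.
rewrite natrM natrX -mulrA ler_pM2l ?exprn_gt0 // natrD natrX mulrDr mulr1.
rewrite lerD2l natr_sum mulrCA !big_distrr /= big_nat [leRHS]big_nat.
apply: ler_sum => t /andP[t0 tn].
have t0' : 0 < t%:R :> F by rewrite ltr0n.
have := sum_rich_curves_le (t := t) f_mono; rewrite t0 -ltnS tn => /(_ isT).
rewrite -/(W t) -(ler_nat F) 2!natrM !natrX => H.
rewrite mulrA ler_pdivlMr //; apply: le_trans H.
by rewrite natrM natrX mulrAC -exprSr.
Qed.

(** * Counting by fibres and Cauchy-Schwarz *)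

Section Counting.
Local Open Scope nat_scope.

Lemma card_sqr_le_collisions (X : finType) (Y : choiceType) (h : X -> Y)
    (V : {set X}) (H : {fset Y}) : (forall x, x \in V -> h x \in H) ->
  #|V| ^ 2 <= #|` H| * #|[set u | [&& u.1 \in V, u.2 \in V & h u.1 == h u.2]]|.
Proof.
move=> VH; case: (pickP (mem V)) => [x0 Vx0|V0]; last first.
  by rewrite (eq_card0 V0).
(* The default [h x0] only makes [k] total; on [V] it agrees with [h]. *)
pose k x : H := insubd (Sub (h x0) (VH _ Vx0)) (h x).
have kE x : x \in V -> val (k x) = h x by move=> /VH hx; rewrite /k insubdK.
pose m y := #|[set x in V | k x == y]|.
have -> : #|V| = \sum_y m y.
  rewrite -sum1_card (partition_big k predT) //=; apply: eq_bigr => y _.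
  by rewrite sum1dep_card.
have -> : #|[set u | [&& u.1 \in V, u.2 \in V & h u.1 == h u.2]]| =
    \sum_y m y ^ 2.
  rewrite -sum1_card (partition_big (fun u => k u.1) predT) //=.
  apply: eq_bigr => y _; rewrite sum1dep_card -mulnn -cardsX; apply: eq_card.
  move=> [x x']; rewrite !inE /=; case: (boolP (x \in V)) => //= xV.
  case: (boolP (x' \in V)) => /= x'V; last by rewrite andbF.
  rewrite -!kE // (inj_eq val_inj); case: (k x =P y) => [->|]; last by rewrite andbF.
  by rewrite andbT eq_sym.
(* Cauchy-Schwarz on the fibre sizes: double, then sum 2 m(y) m(z) <= m(y) ^ 2 + m(z) ^ 2 over all y
   and z. *)
rewrite cardfE -leq_double -mulnn big_distrlr /= -!mul2n big_distrr /=.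
apply: (@leq_trans (\sum_(y : H) \sum_(z : H) (m y ^ 2 + m z ^ 2))).
  by apply: leq_sum => y _; rewrite big_distrr leq_sum // => z _; exact: nat_Cauchy.
rewrite (eq_bigr (fun y => #|{: H}| * m y ^ 2 + \sum_z m z ^ 2)); last first.
  by move=> y _; rewrite big_split /= sum_nat_const.
by rewrite big_split /= -big_distrr sum_nat_const addnn mul2n.
Qed.

Lemma card_ge_fibers (X Y : finType) (U : {set X}) (V : {set X * Y}) k :
  (forall x, x \in U -> k <= #|[set y | (x, y) \in V]|) -> #|U| * k <= #|V|.
Proof.
move=> h; rewrite -sum_nat_const.
apply: (@leq_trans (\sum_(x in U) #|[set y | (x, y) \in V]|)); first exact: leq_sum.
rewrite -[#|V|]sum1_card (partition_big fst predT) //= big_mkcond.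
apply: leq_sum => x _; case: ifP => // _; rewrite sum1dep_card.
have xI : injective (pair x : Y -> X * Y) by move=> y y' [].
rewrite -(card_imset _ xI).
apply/subset_leq_card/fintype.subsetP => z /imsetP[y]; rewrite inE => xy ->.
by rewrite inE xy /=.
Qed.

Lemma card_notin_ge (X : finType) (s : seq X) :
  #|X| - size s <= #|[set x | x \notin s]|.
Proof.
rewrite cardsE leq_subLR -(cardC (mem s)) leq_add //; exact: card_size.
Qed.

End Counting.

(** * Admissible tuples and their collisions *)

Section Tuples.
Variables (R : realType) (n : nat) (f : 'I_n -> R).
Hypothesis f_mono : forall i j, (f i < f j) = (i < j)%N.
Notation I := 'I_n.
Notation T5 := (I * I * I * I * I)%type.

Let f_inj : injective f := grid_inj f_mono.

Definition admissible : {set T5} :=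
  [set x | let: (a, b, c, d, e) := x in uniq [:: a; b; c; d] && uniq [:: a; b; c; e]].

Definition tuple_pair (x : T5) : R * R :=
  let: (a, b, c, d, e) := x in cross_ratio_pair (f a) (f b) (f c) (f d) (f e).

(** Entries are chosen in turn; e has to avoid only a, b, c, whence the repeated factor n - 3. *)
Lemma card_admissible_ge :
  (n * (n - 1) * (n - 2) * (n - 3) * (n - 3) <= #|admissible|)%N.
Proof.
have fib (s : seq I) (Q : pred I) k : size s = k -> (forall i, i \notin s -> Q i) ->
    (n - k <= #|[set i | Q i]|)%N.
  move=> <- sQ; rewrite -{1}(card_ord n); apply: leq_trans (card_notin_ge s) _.
  by apply/subset_leq_card/fintype.subsetP => i; rewrite !inE => /sQ.
pose U2 := [set x : I * I | x.1 != x.2].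
pose U3 := [set x : I * I * I | uniq [:: x.1.1; x.1.2; x.2]].
pose U4 := [set x : I * I * I * I | uniq [:: x.1.1.1; x.1.1.2; x.1.2; x.2]].
have h2 : (n * (n - 1) <= #|U2|)%N.
  rewrite -{1}(card_ord n) -cardsT; apply: card_ge_fibers => a _.
  apply: (@fib [:: a]) => // i; rewrite !inE /=; by rewrite eq_sym.
have h3 : (#|U2| * (n - 2) <= #|U3|)%N.
  apply: card_ge_fibers => -[a b]; rewrite inE /= => ab.
  apply: (@fib [:: a; b]) => // i; rewrite !inE /= !negb_or !(eq_sym i).
  by rewrite ab => /andP[-> ->].
have h4 : (#|U3| * (n - 3) <= #|U4|)%N.
  apply: card_ge_fibers => -[[a b] c]; rewrite inE /= => abc.
  apply: (@fib [:: a; b; c]) => // i; rewrite !inE /= !negb_or !(eq_sym i).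
  by move: abc; rewrite !inE !negb_or => /andP[/andP[-> ->] /andP[-> _]] /and3P[-> -> ->].
have h5 : (#|U4| * (n - 3) <= #|admissible|)%N.
  apply: card_ge_fibers => -[[[a b] c] d]; rewrite inE /= => abcd.
  apply: (@fib [:: a; b; c]) => // i; rewrite !inE /= !negb_or !(eq_sym i).
  move: abcd; rewrite !inE !negb_or.
  by case/and4P=> /and3P[-> -> ->] /andP[-> ->] -> _ /and3P[-> -> ->].
apply: leq_trans h5; rewrite leq_mul2r; apply/orP; right.
apply: leq_trans h4; rewrite leq_mul2r; apply/orP; right.
by apply: leq_trans h3; rewrite leq_mul2r h2 orbT.
Qed.

(** A collision is encoded without loss by the triple [tr] and the two points [de], which equality
    of the cross ratios puts on the curve of that triple. *)
Lemma tuple_pair_collisions_le :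
  (#|[set u | [&& u.1 \in admissible, u.2 \in admissible &
                 tuple_pair u.1 == tuple_pair u.2]]| <=
   \sum_(P | gtriple f P) #|curve f P| ^ 2)%N.
Proof.
pose tr (u : T5 * T5) := let: ((a, b, c, _, _), (a', b', c', _, _)) := u in
  ((a, a'), (b, b'), (c, c')).
pose de (u : T5 * T5) := let: ((_, _, _, d, e), (_, _, _, d', e')) := u in
  ((d, d'), (e, e')).
have gfE (i j : I) : (f i == f j) = (i == j) by rewrite (inj_eq f_inj).
have key u : u.1 \in admissible -> u.2 \in admissible ->
    tuple_pair u.1 = tuple_pair u.2 ->
    [/\ gtriple f (tr u), (de u).1 \in curve f (tr u) & (de u).2 \in curve f (tr u)].
  case: u => [[[[[a b] c] d] e] [[[[a' b'] c'] d'] e']].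
  rewrite !inE /= !inE !negb_or.
  case/andP=> /and4P[/and3P[ab ac ad] /andP[bc bd] cd _].
  case/and4P=> /and3P[_ _ ae] /andP[_ be] ce _.
  case/andP=> /and4P[/and3P[ab' ac' ad'] /andP[bc' bd'] cd' _].
  case/and4P=> /and3P[_ _ ae'] /andP[_ be'] ce' _ [Ed Ee].
  have g : gtriple f ((a, a'), (b, b'), (c, c')).
    by rewrite /gtriple /generic3 /generic /= !gfE ab ab' bc bc' ac ac'.
  split=> //.
    apply/eqP; apply: cross_ratio_eq_mobius_form => //.
    by rewrite /generic /= !gfE ad ad'.
  apply/eqP; apply: cross_ratio_eq_mobius_form => //.
  by rewrite /generic /= !gfE ae ae'.
rewrite -sum1_card (partition_big tr (gtriple f)) /=; last first.
  by move=> u; rewrite inE => /and3P[h1 h2 /eqP h3]; case: (key u h1 h2 h3).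
apply: leq_sum => P gP; rewrite sum1dep_card -mulnn -cardsX.
set X := [set _ | _].
have de_inj : {in X &, injective de}.
  move=> [[[[[a b] c] d] e] [[[[a' b'] c'] d'] e']].
  move=> [[[[[a1 b1] c1] d1] e1] [[[[a1' b1'] c1'] d1'] e1']].
  rewrite !inE => /andP[_ /eqP<-] /andP[_ /eqP[]] -> -> -> -> -> ->.
  by case=> -> -> -> ->.
rewrite -(card_in_imset de_inj); apply/subset_leq_card/fintype.subsetP => z.
case/imsetP=> u; rewrite inE => /andP[]; rewrite inE.
case/and3P=> h1 h2 /eqP h3 /eqP <- ->.
by have [_ k1 k2] := key u h1 h2 h3; rewrite inE k1 k2.
Qed.

End Tuples.

(** * Logarithm bounds and the conclusion *)

Lemma harmonic_le_ln (R : realType) n : (0 < n)%N ->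
  \sum_(1 <= t < n.+1) t%:R^-1 <= 1 + ln n%:R :> R.
Proof.
case: n => // n _; elim: n => [|n IH]; first by rewrite big_nat1 invr1 ln1 addr0.
rewrite big_nat_recr //=; apply: le_trans (lerD IH (lexx _)) _.
(* What remains is ln (1 - 1/(n+2)) <= -1/(n+2), an instance of ln (1 + x) <= x. *)
rewrite -addrA lerD2l -lerBrDl -lerN2 opprB -ln_div ?posrE //.
have -> : n.+1%:R / n.+2%:R = 1 + - n.+2%:R^-1 :> R.
  apply/(mulIf (_ : n.+2%:R != 0 :> R)) => //.
  by rewrite divfK // mulrBl mul1r mulVf // -[in RHS]natr1 addrK.
by apply: le_ln1Dx; rewrite ltrN2 invf_lt1 // ltr1n.
Qed.

(** Apply ln (1 + x) <= x at x = -3/4. This lets additive constants be absorbed into the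
    logarithm. *)
Lemma ln_ge34 (R : realType) n : (4 <= n)%N -> 3 / 4 <= ln n%:R :> R.
Proof.
move=> n4; have n0 : 0 < n%:R :> R by rewrite ltr0n (leq_trans _ n4).
have /le_ln1Dx : -1 < - (3 / 4) :> R by lra.
have -> : 1 + - (3 / 4) = 4^-1 :> R by lra.
rewrite lnV ?posrE // lerN2 => /le_trans; apply.
by rewrite ler_ln ?posrE // ler_nat.
Qed.

Theorem theorem3 (R : realType) :
  exists2 C : R, 0 < C &
    forall A : {fset R}, (4 <= #|` A|)%N ->
      C * (#|` A|%:R ^+ 4 / ln (#|` A|%:R)) <= #|` fset_set (pair_set A)|%:R.
Proof.
exists (2 ^- 38); first by rewrite invr_gt0 exprn_gt0.
move=> A; set n := #|` A| => n4; set H := fset_set _.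
have n0 : (0 < n)%N by apply: leq_trans n4.
pose s := sort <=%R A.
have ss : size s = n by rewrite size_sort.
have slt : sorted <%R s by rewrite sort_lt_sorted fset_uniq.
pose f (i : 'I_n) := nth 0 s i.
have f_mono i j : (f i < f j) = (i < j)%N.
  by rewrite /f (lt_sorted_ltn_nth 0 slt) // inE ss.
have fA i : f i \in A by rewrite -(mem_sort <=%R) mem_nth // ss.
have hH x : x \in admissible n -> tuple_pair f x \in H.
  case: x => [[[[a b] c] d] e]; rewrite inE => /andP[u1 u2].
  rewrite in_fset_set; last exact: finite_pair_set.
  apply/mem_set; exists (f a), (f b), (f c), (f d), (f e); split=> //.
  - by rewrite -[[:: _; _; _; _]]/(map f [:: a; b; c; d]) (map_inj_uniq (grid_inj f_mono)).
  - by rewrite -[[:: _; _; _; _]]/(map f [:: a; b; c; e]) (map_inj_uniq (grid_inj f_mono)).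
have := leq_trans (card_sqr_le_collisions hH)
  (leq_mul (leqnn _) (tuple_pair_collisions_le f_mono)).
rewrite -(ler_nat R) natrM natrX => E1.
have E2 := energy_le n0 f_mono.
have E3 := harmonic_le_ln R n0.
have E4 := ln_ge34 R n4.
(* The constants make n = 4 the case of equality: 128 * 24 = 3 * 4 ^ 5. *)
have E5 : 3 * n%:R ^+ 5 <= 128 * #|admissible n|%:R :> R.
  rewrite -natrX -!natrM ler_nat.
  apply: leq_trans (leq_mul (leqnn _) (card_admissible_ge n)).
  have [m ->] : exists m, n = (m + 4)%N by exists (n - 4)%N; rewrite subnK.
  by rewrite -!addnBA //=; nia.
move: E1 E2 E3 E4 E5.
set E := (\sum_(P | _) _)%N%:R; set V := #|_|%:R; set M := #|` _|%:R.
set L := ln _; set N := n%:R; set h := \sum_(_ <= _ < _) _.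
move=> E1 E2 E3 E4 E5.
have L0 : 0 < L by lra.
have N0 : 0 < N by rewrite ltr0n.
have M0 : 0 <= M by rewrite ler0n.
have V0 : 0 <= V by rewrite ler0n.
(* 1 + 32 (1 + L) <= 76 L amounts exactly to L >= 3/4. *)
have E6 : E <= 2 ^+ 20 * N ^+ 6 * (76 * L).
  apply: le_trans E2 _; rewrite ler_pM2l ?mulr_gt0 ?exprn_gt0 //; lra.
have E7 : 9 * N ^+ 10 <= 2 ^+ 14 * V ^+ 2.
  have -> : 9 * N ^+ 10 = (3 * N ^+ 5) ^+ 2 by ring.
  have -> : 2 ^+ 14 * V ^+ 2 = (128 * V) ^+ 2 by ring.
  by rewrite ler_pXn2r // nnegrE ?mulr_ge0 ?exprn_ge0 // ltW.
have E8 : V ^+ 2 <= M * (2 ^+ 20 * N ^+ 6 * (76 * L)).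
  by apply: le_trans E1 _; rewrite ler_wpM2l.
rewrite mulrA ler_pdivrMr // ler_pdivrMl ?exprn_gt0 //.
have N6 : 0 < N ^+ 6 by rewrite exprn_gt0.
(* Scaling the goal by 9 N ^ 6 lets [E7] and [E8] chain; with C = 2 ^- 38 the comparison ends at 76
   <= 144 = 9 * 2 ^ 4. *)
rewrite -(ler_pM2l N6).
have -> : N ^+ 6 * N ^+ 4 = N ^+ 10 by rewrite -exprD.
have ML : 0 <= M * (N ^+ 6 * L) by rewrite !mulr_ge0 // ltW.
rewrite -(@ler_pM2l _ 9) //; apply: le_trans E7 _.
apply: (@le_trans _ _ (2 ^+ 14 * (M * (2 ^+ 20 * N ^+ 6 * (76 * L))))).
  by rewrite ler_pM2l // exprn_gt0.
have -> : 2 ^+ 14 * (M * (2 ^+ 20 * N ^+ 6 * (76 * L))) =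
  76 * 2 ^+ 34 * (M * (N ^+ 6 * L)) by ring.
have -> : 9 * (N ^+ 6 * (2 ^+ 38 * (M * L))) = 144 * 2 ^+ 34 * (M * (N ^+ 6 * L)) by ring.
by rewrite ler_wpM2r // ler_pM2r ?exprn_gt0 // ler_nat.
Qed.
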